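(* Let $G$ be a group and let $A \subseteq G$ be an infinite generating set for $G$. (1) If $r$ is a positive integer and $0 < L_A(r) < \infty$, then $r > 1$, $L_A(r') = \infty$ for all integers $r'$ with $1 \le r' < r$, and $L_A(r') = 0$ for all integers $r' > r$. (2) If $L_A(r) \in \{0, \infty\}$ for all positive integers $r$, then either $L_A(r) = \infty$ for all positive integers $r$, or there is a positive integer $r$ such that $L_A(r') = \infty$ for all positive integers $r' \le r$ and $L_A(r') = 0$ for all integers $r' > r$.
   Context: A subset $A$ of a group $G$ is a generating set for $G$ if every element of $G$ is a finite product of elements of $A \cup A^{-1}$, where $A^{-1} = \{a^{-1} : a \in A\}$ and the empty product is the identity $e$. Generating sets are not required to be minimal. For $x \in G$, the word length $\ell_A(x)$ is the smallest integer $r \ge 0$ such that $x$ is a product of $r$ elements of $A \cup A^{-1}$ (so $\ell_A(e) = 0$). For every nonnegative integer $r$, the sphere of radius $r$ is $S_A(r) = \{x \in G : \ell_A(x) = r\}$, and the word growth function is $L_A(r) = |S_A(r)| \in \{0,1,2,\ldots\} \cup \{\infty\}$. *)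

(* Defs.v *)
From mathcomp Require Import all_boot all_order all_algebra finmap.
From mathcomp Require Import boolp classical_sets functions cardinality.
From mathcomp Require Export constructive_ereal.

Set Implicit Arguments.
Unset Strict Implicit.
Unset Printing Implicit Defensive.

Local Open Scope classical_set_scope.

(* Elements of G that are a product of exactly r elements of A and A^-1;
   for r = 0 this is {1}. *)
Definition words (G : groupType) (A : set G) (r : nat) : set G :=
  [set x | exists2 s : r.-tuple G,
    [set` s] `<=` A `|` [set a^-1%g | a in A] &
    x = (\prod_(a <- s) a)%g].

Definition generating (G : groupType) (A : set G) : Prop :=
  forall x : G, exists r : nat, words A r x.

(* The value is +oo exactly when x lies outside the subgroup generated by A,
   which does not happen when A is generating. *)
Definition word_length (G : groupType) (A : set G) (x : G) : \bar nat :=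
  match pselect (exists r : nat, `[< words A r x >]) with
  | left xA => (ex_minn xA)%:E
  | right _ => +oo%E
  end.

Definition sphere (G : groupType) (A : set G) (r : nat) : set G :=
  [set x | word_length A x = r%:E].

(* Cardinality in {0, 1, 2, ...} with a single infinite value; \bar int is used
   because \bar nat carries no order. *)
Definition ecard (T : choiceType) (X : set T) : \bar int :=
  if `[< finite_set X >] then (#|` fset_set X|)%:Z%:E else +oo%E.

Definition word_growth (G : groupType) (A : set G) (r : nat) : \bar int :=
  ecard (sphere A r).

(* Main.v *)
Require Import Defs.
From mathcomp Require Import all_boot all_order all_algebra finmap.
From mathcomp Require Import boolp classical_sets functions cardinality.

Local Open Scope classical_set_scope.

(** The heart is [infinite_sphere]: one element of length [r.+1] forces every sphere of radius 1 to
    [r] to be infinite. Multiplying that element on the left by a letter leaves length at least [r],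
    so building the product letter by letter passes through every length from 1 to [r]. Infinitely
    many letters share finitely many stopping places, and right translation is injective, so the
    target sphere is infinite. Contrapositively ([sphere_finite_eq0]), a finite sphere of positive
    radius is followed only by empty ones. Radius 1 itself is infinite, since A lies in the union of
    {1} and that sphere ([infinite_sphere1]). Both parts follow: for (1) apply these facts at [r],
    for (2) at the least positive radius with empty sphere. *)

(** Discrete intermediate values: only upward jumps are bounded, as [f] may drop freely. If
    [f n < k <= f n.+1], the bound on the jump forces [f n.+1 = k]. *)
Lemma nat_ivt (f : nat -> nat) (n k : nat) :
  (forall i, f i.+1 <= (f i).+1) -> f 0 <= k <= f n ->
  exists2 i, i <= n & f i = k.
Proof.
move=> fS; elim: n => [|n IHn] /andP[f0k kfn].
  by exists 0 => //; apply/anti_leq/andP.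
have [kn|nk] := leqP k (f n).
  have [|i ile fik] := IHn; first by rewrite f0k.
  by exists i => //; exact: leqW.
by exists n.+1 => //; apply/anti_leq; rewrite kfn (leq_trans (fS n)).
Qed.

Section WordGrowth.

Set Implicit Arguments.
Unset Strict Implicit.

Variables (G : groupType) (A : set G).

Let letters : set G := A `|` [set a^-1%g | a in A].

Lemma letterV a : letters a -> letters a^-1%g.
Proof.
by case=> [Aa|[b Ab <-]]; [right; exists a | left; rewrite invgK].
Qed.

Lemma words1 a : letters a -> words A 1 a.
Proof.
move=> La; exists [tuple a]; last by rewrite big_seq1.
by move=> b /=; rewrite inE => /eqP ->.
Qed.

Lemma wordsM m n x y : words A m x -> words A n y -> words A (m + n) (x * y)%g.
Proof.
move=> [s sL ->] [t tL ->]; exists [tuple of s ++ t]; last by rewrite big_cat.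
by move=> a /=; rewrite mem_cat => /orP[/sL|/tL].
Qed.

Lemma words0 x : words A 0 x -> x = 1%g.
Proof. by move=> [s _ ->]; rewrite tuple0 big_nil. Qed.

(** Trades the extended-valued [word_length] for minimality among lengths of words, the form in
    which lengths are bounded below. *)
Lemma sphereP r x :
  sphere A r x <-> words A r x /\ forall m, words A m x -> r <= m.
Proof.
rewrite /sphere /= /word_length; case: pselect => [ex|nex]; last first.
  by split=> // -[xr _]; case: nex; exists r; apply/asboolP.
case: ex_minnP => n /asboolP xn nmin; split=> [[<-]|[xr rmin]].
  by split=> // m xm; apply: nmin; apply/asboolP.
congr _%:E; apply/anti_leq; rewrite rmin // andbT.
by apply: nmin; apply/asboolP.
Qed.

Lemma sphere_inj r s x : sphere A r x -> sphere A s x -> r = s.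
Proof. by rewrite /sphere /= => -> []. Qed.

Lemma word_growth_infinite r :
  word_growth A r = +oo%E <-> infinite_set (sphere A r).
Proof. by rewrite /word_growth /ecard; case: asboolP. Qed.

Lemma word_growth_eq0 r : word_growth A r = 0%E <-> sphere A r = set0.
Proof.
rewrite /word_growth /ecard; case: asboolP => [fin|inf]; split=> //.
- by case=> /eqP; rewrite cardfs_eq0 => /eqP; exact: fset_set_set0.
- by move=> ->; rewrite fset_set0.
- by move=> r0; case: inf; rewrite r0.
Qed.

Lemma word_growth_fin r :
  (0 < word_growth A r < +oo)%E ->
  finite_set (sphere A r) /\ sphere A r !=set0.
Proof.
move=> /andP[gt0 fin]; split.
  by apply: contrapT => /word_growth_infinite r_oo; rewrite r_oo in fin.
by apply/set0P/eqP => /word_growth_eq0 r0; rewrite r0 in gt0.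
Qed.

Hypotheses (genA : generating A) (infA : infinite_set A).

Lemma sphere_ex x : exists r, sphere A r x.
Proof.
have ex : exists r, `[< words A r x >].
  by have [r xr] := genA x; exists r; apply/asboolP.
case: (ex_minnP ex) => r /asboolP xr rmin; exists r; apply/sphereP; split=> //.
by move=> m xm; apply: rmin; apply/asboolP.
Qed.

Lemma sphere1 a : A a -> a <> 1%g -> sphere A 1 a.
Proof.
move=> Aa a1; apply/sphereP; split; first by apply: words1; left.
by case=> // /words0.
Qed.

Lemma infinite_sphere1 : infinite_set (sphere A 1).
Proof.
move=> fin1; apply: infA.
apply: (@sub_finite_set _ _ ([set 1%g] `|` sphere A 1)).
  move=> a Aa; have [->|a1] := pselect (a = 1%g); first by left.
  by right; apply: sphere1.
by rewrite finite_setU.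
Qed.

(* For x = a_1 ... a_r.+1 of length r.+1 and b <> 1 in A, the lengths of the
   products b a_1 ... a_i start at 1, end at r or more, and increase by at most
   1 at each step, so some i <= r.+1 yields length k. By pigeonhole a single i
   serves infinitely many b. *)
Lemma infinite_sphere k r :
  0 < k -> k <= r -> sphere A r.+1 !=set0 -> infinite_set (sphere A k).
Proof.
move=> k0 kr [x xS] fink; apply: infA.
have [l lP] := choice sphere_ex.
have lw y : words A (l y) y by case/sphereP: (lP y).
have l_min y m : words A m y -> l y <= m by case/sphereP: (lP y) => _; apply.
have [[s sL xE] _] := (sphereP _ _).1 xS.
have lx : l x = r.+1 by exact: sphere_inj (lP x) xS.
pose p i := (\prod_(a <- take i s) a)%g.
pose F i := [set b : G | sphere A k (b * p i)%g].
apply: (@sub_finite_set _ _ ([set 1%g] `|` \bigcup_(i in `I_r.+2) F i)).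
  move=> b Ab; have [->|b1] := pselect (b = 1%g); [by left | right].
  have lb : l b = 1 by exact: sphere_inj (lP b) (sphere1 Ab b1).
  have [||i ile ik] := @nat_ivt (fun i => l (b * p i)%g) r.+1 k.
  (* Beyond the end of [s] the prefix is constant; before it, one more letter is appended on the
     right. *)
  - move=> i; have [ilt|ige] := ltnP i (size s); last first.
      by rewrite /p !take_oversize // leqW.
    rewrite /p (take_nth 1%g ilt) big_rcons /= mulgA -[(l _).+1]addn1; apply: l_min.
    by apply: wordsM => //; apply/words1/sL; exact: mem_nth.
  - rewrite /p take0 big_nil mulg1 lb k0 /= take_oversize ?size_tuple // -xE.
    (* Since x = b^-1 (b x), [r.+1 = l x <= 1 + l (b * x)], so the last length is at least [r]. *)
    apply: leq_trans kr _; rewrite -ltnS -lx -{1}(mulKg b x) -add1n.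
    by apply: l_min; apply: wordsM => //; apply/words1/letterV; left.
  - by exists i => //; rewrite /F /= -ik.
rewrite finite_setU; split=> //.
apply: bigcup_finite => // i _.
(* [F i] is the preimage of the supposedly finite sphere under right translation by [p i], which is
   injective. *)
apply: (@finite_preimage _ _ (sphere A k) (fun b => b * p i)%g) => //.
by move=> a b _ _; exact: mulIg.
Qed.

Lemma sphere_finite_eq0 k r :
  0 < k -> k < r -> finite_set (sphere A k) -> sphere A r = set0.
Proof.
case: r => // r k0 kr fink; apply/eqP/negPn/negP => /set0P ne.
exact: (infinite_sphere k0 kr ne).
Qed.

End WordGrowth.

Theorem corollary1 (G : groupType) (A : set G)
    (genA : generating A) (infA : infinite_set A) :
  (forall r : nat, 0 < r ->
     (0 < word_growth A r < +oo)%E ->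
     [/\ 1 < r,
         forall r' : nat, 1 <= r' -> r' < r -> word_growth A r' = +oo%E
       & forall r' : nat, r < r' -> word_growth A r' = 0%E])
  /\
  ((forall r : nat, 0 < r ->
      word_growth A r = 0%E \/ word_growth A r = +oo%E) ->
   (forall r : nat, 0 < r -> word_growth A r = +oo%E) \/
   (exists r : nat,
     [/\ 0 < r,
         forall r' : nat, 0 < r' -> r' <= r -> word_growth A r' = +oo%E
       & forall r' : nat, r < r' -> word_growth A r' = 0%E])).
Proof.
split=> [r r0 /word_growth_fin[finr ner]|dich].
  split=> [|r' r'0 r'r|r' rr'].
  - case: r r0 finr {ner} => [|[|//]] // _ fin1.
    by case: (infinite_sphere1 infA fin1).
  - apply/word_growth_infinite; case: r r'r ner {r0 finr} => // r r'r ner.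
    exact: (infinite_sphere genA infA r'0 r'r ner).
  - exact/word_growth_eq0/(sphere_finite_eq0 genA infA r0 rr').
have [?|noninf] := pselect (forall r, 0 < r -> word_growth A r = +oo%E).
  by left.
right.
(* By the dichotomy, a positive radius whose growth is not infinite has growth 0; the least such
   radius is one past the radius sought. *)
have ex : exists r, (0 < r) && `[< word_growth A r = 0%E >].
  apply: contrapT => nex; apply: noninf => r r0.
  case: (dich _ r0) => // rz; case: nex; exists r.
  by rewrite r0; apply/asboolP.
case: (ex_minnP ex) => r /andP[r0 /asboolP rz] rmin.
have sr0 := (word_growth_eq0 _ _).1 rz.
(* The sphere of radius 1 is infinite, hence not empty; this makes the witness [r.-1] positive. *)
have r_gt1 : 1 < r.
  case: r r0 sr0 {rz rmin} => [|[|//]] // _ s0.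
  by case: (infinite_sphere1 infA); rewrite s0.
exists r.-1; split=> [|r' r'0 r'r|r']; first by rewrite -ltnS prednK.
- case: (dich _ r'0) => // r'z.
  have : r <= r' by apply: rmin; rewrite r'0; apply/asboolP.
  by rewrite leqNgt -[r]prednK // ltnS r'r.
(* Radius [r] is empty by choice; beyond it, emptiness propagates because the empty sphere at [r] is
   finite. *)
- rewrite prednK // leq_eqVlt => /predU1P[<- //|rr'].
  apply/word_growth_eq0/(sphere_finite_eq0 genA infA r0 rr').
  by rewrite sr0.
Qed.
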